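(* Let $L\ge 2$, let $p,q\ge 0$ be real, let $\mathfrak{s}\subseteq\Omega=\{1,\dots,L-1\}$ be any sector and let $\overline{\mathfrak{s}}=\Omega\setminus\mathfrak{s}$ be its complementary sector. Then the map $$\omega^\circ: X^*_{\overline{\mathfrak{s}}}\longrightarrow Y_{\mathfrak{s}},\qquad \langle\phi|\longmapsto \overset{\rightarrow}{\varphi}_{\mathfrak{s},\Omega}\,\omega\bigl(\langle\phi|\,\overset{\leftarrow}{\varphi}_{\overline{\mathfrak{s}},\Omega}\bigr)$$ (where on the right-hand side $\langle\phi|\in V^*_{\overline{\mathfrak{s}}}$ is a representative of the class in the quotient $X^*_{\overline{\mathfrak{s}}}$) is a bijection between the genuine components which is spectrum reversing, i.e. it sends eigenvectors of the Hamiltonian in $X^*_{\overline{\mathfrak{s}}}$ with eigenvalue $E$ to eigenvectors of the Hamiltonian in $Y_{\mathfrak{s}}$ with eigenvalue $-L(p+q)-E$. In particular, as multisets, $$\mathrm{Spec}^\circ(\overline{\mathfrak{s}})=-L(p+q)-\mathrm{Spec}^\circ(\mathfrak{s}).$$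
   Context: Sectors. Fix $L\ge 2$ and $\Omega=\{1,\dots,L-1\}$. A sector is a subset $\mathfrak{s}=\{s_1<\dots<s_{n-1}\}$ of $\Omega$; write $s_0=0$, $s_n=L$. $\mathcal{P}(\mathfrak{s})$ is the set of all sequences $k=(k_1,\dots,k_L)$ in which each value $i\in\{1,\dots,n\}$ occurs exactly $s_i-s_{i-1}$ times (so $\mathcal{P}(\emptyset)=\{(1,\dots,1)\}$ and $\mathcal{P}(\Omega)$ is the set of permutations of $(1,\dots,L)$). $V_{\mathfrak{s}}$ is the complex vector space with basis $|k\rangle$, $k\in\mathcal{P}(\mathfrak{s})$, and $V_{\mathfrak{s}}^*$ the one with dual basis $\langle k|$, $k\in \mathcal{P}(\mathfrak{s})$, with pairing $\langle k|j\rangle=\delta_{k,j}$. The symbol $\subset$ between sectors denotes strict inclusion. Hamiltonian. For real $p,q\ge0$ let $\Theta(x)=p$ for $x>0$, $0$ for $x=0$, $q$ for $x<0$. $H_{\mathfrak{s}}:V_{\mathfrak{s}}\to V_{\mathfrak{s}}$ is the linear map $H_{\mathfrak{s}}|k\rangle=\sum_{i\in\mathbb{Z}/L\mathbb{Z}}\Theta(k_i-k_{i+1})\bigl(|k^{(i)}\rangle-|k\rangle\bigr)$, where indices are taken mod $L$ and $k^{(i)}$ is $k$ with $k_i$ and $k_{i+1}$ interchanged. $H_{\mathfrak{s}}$ acts on $V_{\mathfrak{s}}^*$ from the right by $(\langle k|H_{\mathfrak{s}})|j\rangle=\langle k|(H_{\mathfrak{s}}|j\rangle)$. Operators $\varphi$.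 For sectors $\mathfrak{s}\subseteq\mathfrak{t}=\{t_1<\dots<t_n\}$ with $\mathfrak{s}=\mathfrak{t}\setminus\{t_{i_1},\dots,t_{i_l}\}$, the linear map $\overset{\rightarrow}{\varphi}_{\mathfrak{s},\mathfrak{t}}:V_{\mathfrak{t}}\to V_{\mathfrak{s}}$ is $|k_1,\dots,k_L\rangle\mapsto|k_1',\dots,k_L'\rangle$ with $x'=x-\sharp\{j\mid i_j<x\}$ (identity if $\mathfrak{s}=\mathfrak{t}$). $\overset{\leftarrow}{\varphi}_{\mathfrak{s},\mathfrak{t}}:V_{\mathfrak{s}}^*\to V_{\mathfrak{t}}^*$ is its dual map, written as a right action: $\langle k|\,\overset{\leftarrow}{\varphi}_{\mathfrak{s},\mathfrak{t}}=\sum\langle j|$ over $j\in\mathcal{P}(\mathfrak{t})$ with $\overset{\rightarrow}{\varphi}_{\mathfrak{s},\mathfrak{t}}|j\rangle=|k\rangle$. Map $\omega$. $\omega:V_\Omega^*\to V_\Omega$ is the linear bijection $\langle k_1,\dots,k_L|\mapsto\mathrm{sgn}(k)\,|k_L,\dots,k_1\rangle$, with $\mathrm{sgn}(k)$ the signature of the permutation $k$. Genuine components. $X^*_{\mathfrak{s}}=V^*_{\mathfrak{s}}\big/\sum_{\mathfrak{u}\subset\mathfrak{s}}\mathrm{Im}\,\overset{\leftarrow}{\varphi}_{\mathfrak{u},\mathfrak{s}}$ and $Y_{\mathfrak{s}}=\bigcap_{\mathfrak{u}\subset\mathfrak{s}}\mathrm{Ker}\,\overset{\rightarrow}{\varphi}_{\mathfrak{u},\mathfrak{s}}$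 (with $X^*_\emptyset=V^*_\emptyset$, $Y_\emptyset=V_\emptyset$). Since $\overset{\rightarrow}{\varphi}_{\mathfrak{u},\mathfrak{s}}H_{\mathfrak{s}}=H_{\mathfrak{u}}\overset{\rightarrow}{\varphi}_{\mathfrak{u},\mathfrak{s}}$, $H_{\mathfrak{s}}$ acts on both, and they are canonically dual. $\mathrm{Spec}^\circ(\mathfrak{s})$ is the multiset of eigenvalues (with algebraic multiplicity) of $H_{\mathfrak{s}}$ acting on $X^*_{\mathfrak{s}}$, equivalently on $Y_{\mathfrak{s}}$. For a multiset $A$ of numbers, $-c-A$ is the multiset $\{-c-a\mid a\in A\}$. *)

(* Defs.v *)
From HB Require Import structures.
From mathcomp Require Import all_boot all_order all_algebra.
From mathcomp Require Import perm.

Set Implicit Arguments.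
Unset Strict Implicit.
Unset Printing Implicit Defensive.

Import Order.TTheory GRing.Theory Num.Theory.

Local Open Scope ring_scope.
Local Open Scope quotient_scope.

(* MathComp has quotients of zmodTypes only; we make the quotient of a vector
   space by a subspace into a vectType. *)
Section QuotientSpace.

Variables (K : fieldType) (vT : vectType K) (U : {vspace vT}).

Definition quotv : Type := Quotient.quot (pred_of_vspace U : zmodClosed vT).

HB.instance Definition _ := EqQuotient.on quotv.
HB.instance Definition _ := GRing.Zmodule.on quotv.

Definition quotv_pi (x : vT) : quotv := \pi_quotv x.

Lemma quotv_piE x y : (quotv_pi x == quotv_pi y) = (x - y \in U).
Proof.
exact: esym (Quotient.idealrBE (pred_of_vspace U : zmodClosed vT) x y).
Qed.

Lemma quotv_reprK (x : quotv) : quotv_pi (repr x) = x.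
Proof. exact: reprK. Qed.

Lemma quotv_piD x y : quotv_pi (x + y) = quotv_pi x + quotv_pi y.
Proof. exact: Quotient.pi_add. Qed.

Definition quotv_scale (a : K) (x : quotv) : quotv := quotv_pi (a *: repr x).

Lemma quotv_piZ_ a x : quotv_pi (a *: x) = quotv_scale a (quotv_pi x).
Proof.
apply/eqP; rewrite quotv_piE -scalerBr memvZ //.
by rewrite -quotv_piE quotv_reprK.
Qed.

Fact quotv_scaleA a b v :
  quotv_scale a (quotv_scale b v) = quotv_scale (a * b) v.
Proof. by rewrite -[v]quotv_reprK -!quotv_piZ_ scalerA. Qed.

Fact quotv_scale1 : left_id 1 quotv_scale.
Proof. by move=> v; rewrite -[v]quotv_reprK -!quotv_piZ_ scale1r. Qed.

Fact quotv_scaleDr : right_distributive quotv_scale +%R.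
Proof.
move=> a x y; rewrite -[x]quotv_reprK -[y]quotv_reprK.
by rewrite -quotv_piD -!quotv_piZ_ scalerDr quotv_piD.
Qed.

Fact quotv_scaleDl v : {morph quotv_scale^~ v : a b / a + b}.
Proof.
by move=> a b; rewrite -[v]quotv_reprK -!quotv_piZ_ scalerDl quotv_piD.
Qed.

HB.instance Definition _ := GRing.Zmodule_isLmodule.Build K quotv
  quotv_scaleA quotv_scale1 quotv_scaleDr quotv_scaleDl.

Lemma quotv_piZ a x : quotv_pi (a *: x) = a *: quotv_pi x.
Proof. exact: quotv_piZ_. Qed.

Fact quotv_pi_linear : linear quotv_pi.
Proof. by move=> a x y; rewrite quotv_piD quotv_piZ. Qed.

HB.instance Definition _ := GRing.isSemilinear.Build K vT quotv _ quotv_pi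
  (GRing.semilinear_linear quotv_pi_linear).

(* The quotient is isomorphic to the complement U^C. *)
Fact quotv_vect_iso : Vector.axiom (\dim U^C) quotv.
Proof.
have dxU : (U^C :&: U = 0)%VS by rewrite capvC capv_compl.
pose pr := daddv_pi U^C U.
have prU u : u \in U -> pr u = 0.
  move=> Uu; have UCu : u \in (U^C + U)%VS by rewrite addvC addv_complf memvf.
  have := daddv_pi_add dxU UCu; rewrite (daddv_pi_id (capv_compl U) Uu).
  by move/(canRL (addrK u)); rewrite subrr.
have prD x : x - pr x \in U.
  have UCx : x \in (U^C + U)%VS by rewrite addvC addv_complf memvf.
  by rewrite -{1}(daddv_pi_add dxU UCx) addrC addKr memv_pi.
have pr_pi x y : quotv_pi x = quotv_pi y -> pr x = pr y.
  move/eqP; rewrite quotv_piE => /prU.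
  by rewrite linearB /= => /eqP; rewrite subr_eq0 => /eqP.
pose c x : 'rV_(\dim U^C) := \row_i coord (vbasis U^C) i (pr x).
have c_pi x : c (repr (quotv_pi x)) = c x.
  by rewrite /c (pr_pi _ x) ?quotv_reprK.
have c_linear : linear c.
  by move=> a x y; apply/rowP=> i; rewrite !mxE !linearP.
exists (fun x : quotv => c (repr x)) => [a x y|].
  rewrite -[x]quotv_reprK -[y]quotv_reprK -quotv_piZ -quotv_piD !c_pi.
  exact: c_linear.
exists (fun r : 'rV_(\dim U^C) =>
          quotv_pi (\sum_i r 0 i *: (vbasis U^C)`_i)) => [x|r].
  rewrite -[RHS]quotv_reprK; apply/eqP; rewrite quotv_piE.
  under eq_bigr do rewrite mxE.
  by rewrite -coord_vbasis ?memv_pi // -opprB rpredN prD.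
rewrite c_pi; apply/rowP=> i; rewrite mxE /pr daddv_pi_id //.
  by rewrite coord_sum_free ?(basis_free (vbasisP _)).
by apply: rpred_sum => j _; rewrite rpredZ ?vbasis_mem ?memt_nth.
Qed.

HB.instance Definition _ := Lmodule_hasFinDim.Build K quotv quotv_vect_iso.

End QuotientSpace.

Arguments quotv_pi {K vT} U x.

Lemma linfunE (K : fieldType) (aT rT : vectType K) (f : aT -> rT) :
  linear f -> linfun f =1 f.
Proof.
move=> lin_f v; pose m := GRing.isSemilinear.Build K aT rT _ f
  (GRing.semilinear_linear lin_f).
pose g : {linear aT -> rT} := HB.pack f m.
exact: (lfunE g).
Qed.

Section InducedEndomorphisms.

Variables (K : fieldType) (vT : vectType K) (U : {vspace vT}).

(* These are the endomorphisms induced by f on vT / U and on U when f maps U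
   into itself; see quot_endE and sub_endE. *)
Definition quot_end (f : 'End(vT)) : 'End(quotv U) :=
  linfun (fun x : quotv U => quotv_pi U (f (repr x))).

Definition sub_end (f : 'End(vT)) : 'End(subvs_of U) :=
  linfun (fun y : subvs_of U => vsproj U (f (vsval y))).

Lemma quot_endE f v : (f @: U <= U)%VS ->
  quot_end f (quotv_pi U v) = quotv_pi U (f v).
Proof.
move=> fU.
have pif u w : quotv_pi U u = quotv_pi U w ->
    quotv_pi U (f u) = quotv_pi U (f w).
  move/eqP; rewrite quotv_piE => Uuw; apply/eqP.
  by rewrite quotv_piE -linearB (subvP fU) // memv_img.
have lin_g : linear (fun x : quotv U => quotv_pi U (f (repr x))).
  move=> a x y; rewrite -quotv_piZ -quotv_piD -linearP.
  by apply: pif; rewrite quotv_piD quotv_piZ !quotv_reprK.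
rewrite /quot_end linfunE //; apply: pif; exact: quotv_reprK.
Qed.

Lemma sub_endE f y : (f @: U <= U)%VS -> vsval (sub_end f y) = f (vsval y).
Proof.
move=> fU; rewrite /sub_end linfunE => [|a x z]; last by rewrite /= !linearP.
  by rewrite vsprojK // (subvP fU) // memv_img // subvsP.
Qed.

End InducedEndomorphisms.

Arguments quot_end {K vT} U f.
Arguments sub_end {K vT} U f.

(* The roots, with multiplicity, of the characteristic polynomial; a multiset
   is a sequence up to perm_eq. *)
Definition spectrum (C : closedFieldType) (vT : vectType C) (f : 'End(vT)) :
    seq C :=
  sval (closed_field_poly_normal
          (char_poly (passmx.mxof (vbasis {:vT}) (vbasis {:vT}) f))).

(* The element e : 'I_L.-1 stands for the element e + 1 of Omega. *)
Definition sector (L : nat) := {set 'I_L.-1}.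

(* cut s j is s_j; in particular it is L for j >= n. *)
Definition cut (L : nat) (s : sector L) (j : nat) : nat :=
  nth L (0%N :: [seq (val e).+1 | e <- enum s]) j.

(* The position i : 'I_L stands for i + 1, and the letter x : 'I_L stands for
   the value x + 1. *)
Definition word (L : nat) := {ffun 'I_L -> 'I_L}.

(* Letters x with x + 1 > n occur cut s x.+1 - cut s x = L - L = 0 times. *)
Definition sector_words (L : nat) (s : sector L) : {set word L} :=
  [set k : word L |
    [forall x : 'I_L,
       #|[set i | k i == x]| == (cut s x.+1 - cut s x)%N]].

Definition conf (L : nat) (s : sector L) := {k : word L | k \in sector_words s}.

Definition swap (L : nat) (k : word L) (i : 'I_L) : word L :=
  [ffun j => k (tperm i (ordS i) j)].

Definition rev_word (L : nat) (k : word L) : word L := [ffun i => k (rev_ord i)].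

(* The default value 1 is used only when k is not a permutation. *)
Definition odd_word (L : nat) (k : word L) : bool :=
  odd_perm (insubd (1%g : {perm 'I_L}) k).

Lemma odd_wordE (L : nat) (s : {perm 'I_L}) : odd_word (val s) = odd_perm s.
Proof. by rewrite /odd_word valKd. Qed.

(* For t = {t_1 < ... < t_n}, an element e of t is t_j with
   j = index e (enum t) + 1; both j and the letter are shifted by one. *)
Definition merge_letter (L : nat) (s t : sector L) (x : 'I_L) : 'I_L :=
  Ordinal (leq_ltn_trans
    (leq_subr #|[set e in t :\: s | (index e (enum t) < x)%N]| x)
    (ltn_ord x)).

Definition merge_word (L : nat) (s t : sector L) (k : word L) : word L :=
  [ffun i => merge_letter s t (k i)].

Section WordsTheory.

Variable L : nat.

Implicit Types (s t : sector L) (k : word L).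

Let vals t := [seq val e | e <- enum t].

Let size_vals t : size (vals t) = #|t|.
Proof. by rewrite size_map cardE. Qed.

Let vals_sorted t : sorted ltn (vals t).
Proof.
rewrite /vals; apply: (subseq_sorted ltn_trans) (iota_ltn_sorted 0 L.-1).
have -> : enum t = [seq e <- enum 'I_L.-1 | e \in t] by rewrite enumT.
by rewrite -val_enum_ord map_subseq // filter_subseq.
Qed.

Let cutS t j :
  cut t j.+1 = if (j < #|t|)%N then (nth L (vals t) j).+1 else L.
Proof.
rewrite /cut /=; rewrite (map_comp S val) -/(vals t) -size_vals.
case: ltnP => jt; first by rewrite (nth_map L).
by rewrite nth_default // size_map.
Qed.

Let nth_vals_lt t j : (j < #|t|)%N -> (nth L (vals t) j < L.-1)%N.
Proof.
rewrite -size_vals => jt.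
by have /mapP[e _ ->] := mem_nth L jt; apply: ltn_ord.
Qed.

Let vals_mono t i j : (i < #|t|)%N -> (j < #|t|)%N ->
  (nth L (vals t) i < nth L (vals t) j)%N = (i < j)%N.
Proof.
rewrite -size_vals => it jt.
exact: (lt_sorted_ltn_nth L (vals_sorted t : sorted <%O (vals t))).
Qed.

Let card_sector t : (#|t| <= L.-1)%N.
Proof. by rewrite -[leqRHS]card_ord max_card. Qed.

Lemma cut_le t j : (cut t j <= L)%N.
Proof.
case: j => // j; rewrite cutS; case: ifP => // /nth_vals_lt.
by move/leq_trans; apply; apply: leq_pred.
Qed.

Lemma cutL t : cut t L = L.
Proof.
have cutj j : j.+1 = L -> cut t j.+1 = L.
  move=> jL; rewrite cutS ltnNge.
  by have -> : (#|t| <= j)%N by rewrite (leq_trans (card_sector t)) // -{1}jL.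
case: (posnP L) => [L0|/prednK L1]; last first.
  have := cutj _ L1; by rewrite {1}L1.
apply/eqP; rewrite eqn_leq cut_le /=.
by apply: leq_trans (leq0n _); rewrite L0.
Qed.

Lemma cut_mono t : {homo cut t : i j / (i <= j)%N}.
Proof.
apply: homo_leq => [//|x y z|i]; first exact: leq_trans.
rewrite [leqRHS]cutS; case: ltnP => it; last exact: cut_le.
by case: i it => // i it; rewrite cutS (ltnW it) ltnW // ltnS vals_mono // ltnW.
Qed.

Lemma index_lt_cut t e x :
  e \in t -> (index e (enum t) < x)%N = (e < cut t x)%N.
Proof.
move=> te; case: x => [|x]; first by rewrite !ltn0.
have ie : (index e (enum t) < #|t|)%N by rewrite cardE index_mem mem_enum.
rewrite cutS; case: (ltnP x) => xt.
  have -> : nat_of_ord e = nth L (vals t) (index e (enum t)).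
    by rewrite (nth_map e) -?cardE // nth_index ?mem_enum.
  by rewrite !ltnS [RHS]leqNgt [LHS]leqNgt vals_mono.
rewrite ltnS (leq_trans (ltnW ie) xt); apply/esym.
exact: leq_trans (ltn_ord e) (leq_pred _).
Qed.

Lemma card_lt_index t x :
  #|[set e in t | (index e (enum t) < x)%N]| = minn x #|t|.
Proof.
have mem_take : [set e in t | (index e (enum t) < x)%N] =i take x (enum t).
  move=> e; rewrite inE; case: (boolP (e \in t)) => te /=.
    by rewrite in_take ?mem_enum.
  by apply/esym/negP => /mem_take; rewrite mem_enum (negPf te).
rewrite (eq_card mem_take) (card_uniqP _) ?take_uniq ?enum_uniq //.
by rewrite size_take_min cardE.
Qed.

Lemma card_lt_cut s c y :
  (c < L)%N -> (#|[set e in s | (val e < c)%N]| < y)%N = (c < cut s y)%N.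
Proof.
move=> cL; case: y => [|y]; first by rewrite ltn0.
rewrite cutS; case: (ltnP y) => ys; last first.
  rewrite cL ltnS (leq_trans _ ys) // subset_leq_card //.
  by apply/subsetP => e; rewrite inE => /andP[].
have se : exists2 e, e \in s & nat_of_ord e = nth L (vals s) y.
  have /mapP[e es ->] : nth L (vals s) y \in vals s by rewrite mem_nth ?size_vals.
  by exists e => //; rewrite mem_enum in es.
case: se => e se Ee; rewrite -Ee !ltnS.
have cardlt d : #|[set e in s | (val e < cut s d)%N]| = minn d #|s|.
  rewrite -card_lt_index; apply: eq_card => f; rewrite !inE.
  by case: (boolP (f \in s)) => //= fs; rewrite index_lt_cut.
apply/idP/idP => [le_y|ce].
  rewrite leqNgt; apply/negP => ec; move: le_y; apply/negP; rewrite -ltnNge.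
  have <- : minn y.+1 #|s| = y.+1 by apply/minn_idPl.
  rewrite -cardlt subset_leq_card //; apply/subsetP => f; rewrite !inE.
  by case/andP=> -> /leq_trans; apply; rewrite cutS ys -Ee.
have /minn_idPl <- : (y <= #|s|)%N by exact: ltnW.
rewrite -cardlt subset_leq_card //; apply/subsetP => f; rewrite !inE.
case/andP=> fs fc; rewrite fs /= -index_lt_cut // ltnNge.
apply/negP => yf; move: (leq_trans fc ce); rewrite ltnNge => /negP; apply.
have fi : (index f (enum s) < #|s|)%N by rewrite cardE index_mem mem_enum.
have Ef : nat_of_ord f = nth L (vals s) (index f (enum s)).
  by rewrite (nth_map f) -?cardE // nth_index ?mem_enum.
by rewrite -[\val f]/(nat_of_ord f) Ef Ee leqNgt vals_mono // -leqNgt.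
Qed.

Lemma sector_wordsP t k :
  reflect (forall x, (x <= L)%N -> #|[set i | (k i < x)%N]| = cut t x)
          (k \in sector_words t).
Proof.
have cardS x (xL : (x < L)%N) : #|[set i | (k i < x.+1)%N]| =
    (#|[set i | (k i < x)%N]| + #|[set i | k i == Ordinal xL]|)%N.
  rewrite -cardsUI addnC; set I := _ :&: _; have -> : I = set0.
    apply/setP => i; rewrite !inE -val_eqE /=.
    by apply/negP => /andP[/[swap] /eqP ->]; rewrite ltnn.
  rewrite cards0; congr #|pred_of_set _|; apply/setP => i.
  by rewrite !inE -val_eqE /= ltnS leq_eqVlt orbC.
rewrite inE; apply: (iffP forallP) => [kt|kt x].
  elim=> [_|x IH xL].
    by apply/eqP; rewrite cards_eq0; apply/eqP/setP => i; rewrite !inE.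
  rewrite (cardS x xL) IH 1?ltnW // (eqP (kt (Ordinal xL))).
  by rewrite subnKC // cut_mono.
have := cardS x (ltn_ord x); rewrite !kt ?ltn_ord 1?ltnW // => ->.
by rewrite addKn; apply/eqP; congr #|pred_of_set _|;
   apply/setP => i; rewrite !inE -val_eqE.
Qed.

Lemma cut_lt_letter t k i : k \in sector_words t ->
  (cut t (k i) < cut t (k i).+1)%N.
Proof.
rewrite inE => /forallP /(_ (k i)) /eqP kt.
rewrite -subn_gt0 -kt; apply/card_gt0P; exists i.
by rewrite inE.
Qed.

Lemma merge_letterE s t k i : s \subset t -> k \in sector_words t ->
  merge_letter s t (k i) = #|[set e in s | (val e < cut t (k i))%N]| :> nat.
Proof.
move=> st kt; rewrite /=.
have xt : (k i <= #|t|)%N.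
  rewrite leqNgt; apply/negP => xt; have := cut_lt_letter i kt.
  case: (nat_of_ord (k i)) xt => // x; rewrite ltnS => xt.
  by rewrite !cutS !(ltnNge _ #|t|) xt (leqW xt) ltnn.
have := card_lt_index t (k i); rewrite (minn_idPl xt).
set A := [set e in t | _]; rewrite -(cardsID s A) => /esym Ex.
have -> : [set e in s | (val e < cut t (k i))%N] = A :&: s.
  apply/setP => e; rewrite !inE.
  case: (boolP (e \in s)) => es; rewrite ?andbF //= andbT.
  by have et := subsetP st _ es; rewrite et index_lt_cut.
rewrite {1}Ex; have -> : [set e in t :\: s | (index e (enum t) < k i)%N] = A :\: s.
  by apply/setP => e; rewrite !inE andbA.
by rewrite addnK.
Qed.

Lemma merge_word_sector s t k : s \subset t -> k \in sector_words t ->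
  merge_word s t k \in sector_words s.
Proof.
move=> st kt; apply/sector_wordsP => y yL.
have [z zL Ez] : exists2 z, (z <= L)%N & cut s y = cut t z.
  case: y yL => [|y] yL; first by exists 0%N.
  rewrite cutS; case: ltnP => [ys|_]; last by exists L; rewrite ?cutL.
  have /mapP[e es ->] : nth L (vals s) y \in vals s.
    by rewrite mem_nth ?size_vals.
  have et : e \in t by rewrite (subsetP st) // -mem_enum.
  have it : (index e (enum t) < #|t|)%N by rewrite cardE index_mem mem_enum.
  exists (index e (enum t)).+1.
    by rewrite (leq_trans it) // (leq_trans (card_sector t)) ?leq_pred.
  by rewrite cutS it (nth_map e) -?cardE // nth_index ?mem_enum.
rewrite Ez; have /sector_wordsP <- // := kt; apply: eq_card => i.
rewrite !inE ffunE merge_letterE // card_lt_cut; last first.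
  exact: leq_trans (cut_lt_letter i kt) (cut_le _ _).
rewrite Ez; apply/idP/idP => [|kz].
  by apply: contraTT; rewrite -!leqNgt => /cut_mono.
by apply: leq_trans (cut_lt_letter i kt) _; apply: cut_mono.
Qed.

Lemma merge_letter_mono s t k i j : s \subset t -> k \in sector_words t ->
  (k i <= k j)%N -> (merge_letter s t (k i) <= merge_letter s t (k j))%N.
Proof.
move=> st kt kij; rewrite !merge_letterE // subset_leq_card //.
apply/subsetP => e; rewrite !inE => /andP[-> /leq_trans]; apply.
exact: cut_mono.
Qed.

Lemma merge_swap s t k i :
  merge_word s t (swap k i) = swap (merge_word s t k) i.
Proof. by apply/ffunP => j; rewrite !ffunE. Qed.

Lemma swap_sector s k i :
  (swap k i \in sector_words s) = (k \in sector_words s).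
Proof.
rewrite !inE; apply: eq_forallb => x; congr (_ == _).
rewrite -(card_imset _ (@perm_inj _ (tperm i (ordS i)))).
apply: eq_card => j; rewrite !inE; apply/imsetP/idP => [[j']|kj].
  by rewrite inE ffunE => kj' ->.
by exists (tperm i (ordS i) j); rewrite ?inE ?ffunE ?tpermK.
Qed.

Lemma swap_id k i : k i = k (ordS i) -> swap k i = k.
Proof. by move=> ki; apply/ffunP => j; rewrite ffunE; case: tpermP => // ->. Qed.

End WordsTheory.

Section Spaces.

Variables (K : fieldType) (L : nat) (p q : K).

Implicit Types s t u : sector L.

Definition V s : Type := {ffun conf s -> K^o}.
HB.instance Definition _ s := Vector.on (V s).

Definition Vdual s : Type := 'Hom(V s, K^o).
HB.instance Definition _ s := Vector.on (Vdual s).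

(* ket s w is the basis vector |w> if w is in P(s), and 0 otherwise; likewise
   for bra s w. *)
Definition ket s (w : word L) : V s := [ffun k : conf s => (val k == w)%:R].

Definition bra s (w : word L) : Vdual s :=
  linfun (fun v : V s => \sum_(k : conf s | val k == w) (v k : K^o)).

(* The linear map that sends |k> to b k for all k in P(t). *)
Definition linext s t (b : word L -> V s) : 'Hom(V t, V s) :=
  linfun (fun v : V t => \sum_(k : conf t) (v k : K) *: b (val k)).

Definition dual_map s t (f : 'Hom(V t, V s)) : 'Hom(Vdual s, Vdual t) :=
  linfun (fun phi : Vdual s => (phi \o f)%VF).

Definition Theta (x : int) : K := if x > 0 then p else if x < 0 then q else 0.

Definition H s : 'End(V s) :=
  linext s (fun k => \sum_(i < L)
    Theta ((k i)%:Z - (k (ordS i))%:Z) *: (ket s (swap k i) - ket s k)).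

Definition Hdual s : 'End(Vdual s) := dual_map (H s).

Definition phi_right s t : 'Hom(V t, V s) :=
  linext t (fun k => ket s (merge_word s t k)).

Definition phi_left s t : 'Hom(Vdual s, Vdual t) := dual_map (phi_right s t).

(* f (ket setT k) is the coefficient of <k| in f; see omega_bra. *)
Definition omega : 'Hom(Vdual [set: 'I_L.-1], V [set: 'I_L.-1]) :=
  linfun (fun f : Vdual [set: 'I_L.-1] =>
    \sum_(k : conf [set: 'I_L.-1])
      ((-1) ^+ odd_word (val k) * (f (ket setT (val k)) : K)) *:
        ket setT (rev_word (val k))).

Definition imgs s : {vspace Vdual s} :=
  (\sum_(u : sector L | u \proper s) limg (phi_left u s))%VS.

Definition X s : Type := quotv (imgs s).
HB.instance Definition _ s := Vector.on (X s).

Definition Y s : {vspace V s} :=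
  (\bigcap_(u : sector L | u \proper s) lker (phi_right u s))%VS.

Definition HX s : 'End(X s) := quot_end (imgs s) (Hdual s).

Definition HY s : 'End(subvs_of (Y s)) := sub_end (Y s) (H s).

End Spaces.

Section SpacesTheory.

Variables (K : fieldType) (L : nat) (p q : K).

Implicit Types s t u : sector L.

Lemma V_basis s (v : V K s) :
  v = \sum_(k : conf s) (v k : K) *: ket K s (val k).
Proof.
apply/ffunP => j; rewrite sum_ffunE (bigD1 j) //= !ffunE eqxx.
rewrite big1 ?addr0 ?[_ *: _]mulr1 // => k kj.
by rewrite !ffunE (inj_eq val_inj) eq_sym (negPf kj) scaler0.
Qed.

Lemma linextE s t (b : word L -> V K s) k :
  k \in sector_words t -> linext t b (ket K t k) = b k.
Proof.
move=> kt; rewrite /linext linfunE => [|a v w].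
  rewrite (bigD1 (exist _ k kt)) //= !ffunE eqxx scale1r big1 ?addr0 // => j.
  by rewrite -val_eqE /= ffunE => /negPf ->; rewrite scale0r.
rewrite /= scaler_sumr -big_split /=; apply: eq_bigr => k' _.
by rewrite !ffunE scalerDl scalerA.
Qed.

Lemma Hom_ext s (rT : vectType K) (f g : 'Hom(V K s, rT)) :
  (forall k, k \in sector_words s -> f (ket K s k) = g (ket K s k)) -> f = g.
Proof.
move=> fg; apply/lfunP => v; rewrite (V_basis v) !linear_sum.
by apply: eq_bigr => k _; rewrite !linearZ /= fg //; apply: (valP k).
Qed.

Lemma H_ket s k : k \in sector_words s ->
  H p q s (ket K s k) = \sum_(i < L)
    (Theta p q ((k i)%:Z - (k (ordS i))%:Z)) *:
      (ket K s (swap k i) - ket K s k).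
Proof. exact: linextE. Qed.

Lemma phi_right_ket s t k : k \in sector_words t ->
  phi_right K s t (ket K t k) = ket K s (merge_word s t k).
Proof. exact: linextE. Qed.

Lemma dual_mapE s t (f : 'Hom(V K t, V K s)) phi :
  dual_map f phi = (phi \o f)%VF.
Proof.
rewrite /dual_map linfunE // => a x y.
by rewrite comp_lfunDl comp_lfunZl.
Qed.

Lemma bra_ket s j k : k \in sector_words s ->
  bra K s j (ket K s k) = (j == k)%:R.
Proof.
move=> ks; rewrite /bra linfunE => [|a v w].
  rewrite big_mkcond (bigD1 (exist _ k ks)) //= !ffunE eqxx [j == k]eq_sym.
  rewrite big1 ?addr0 => [|i]; first by case: eqP.
  by rewrite -val_eqE /= ffunE => /negPf ->; case: ifP.
rewrite /= scaler_sumr -big_split /=; apply: eq_bigr => i _.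
by rewrite !ffunE.
Qed.

Lemma phi_left_bra s t k :
  s \subset t ->
  phi_left K s t (bra K s k) =
    \sum_(j : conf t | merge_word s t (val j) == k) bra K t (val j).
Proof.
move=> st; apply: Hom_ext => j jt.
rewrite dual_mapE comp_lfunE phi_right_ket // bra_ket ?merge_word_sector //.
rewrite sum_lfunE; under eq_bigr do rewrite bra_ket //.
rewrite big_mkcond (bigD1 (exist _ j jt)) //= eqxx eq_sym.
rewrite big1 ?addr0 => [|i]; first by case: eqP.
by rewrite -val_eqE /= => /negPf ->; case: ifP.
Qed.

Lemma omega_bra k : k \in sector_words [set: 'I_L.-1] ->
  omega K L (bra K setT k) = (-1) ^+ odd_word k *: ket K setT (rev_word k).
Proof.
move=> kT; rewrite /omega linfunE => [|a v w].
  rewrite (bigD1 (exist _ k kT)) //= bra_ket // eqxx mulr1 big1 ?addr0 // => j.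
  rewrite -val_eqE /= => jk; rewrite bra_ket; last exact: (valP j).
  by rewrite eq_sym (negPf jk) mulr0 scale0r.
rewrite /= scaler_sumr -big_split /=; apply: eq_bigr => j _.
rewrite add_lfunE scale_lfunE scalerA -scalerDl; congr (_ *: _).
by rewrite mulrDr [in LHS]mulrCA.
Qed.

Lemma phi_right_H s t : s \subset t ->
  (phi_right K s t \o H p q t = H p q s \o phi_right K s t)%VF.
Proof.
move=> st; apply: Hom_ext => k kt; rewrite !comp_lfunE.
rewrite phi_right_ket // !H_ket ?merge_word_sector // linear_sum /=.
apply: eq_bigr => i _; rewrite linearZ linearB /=.
rewrite !phi_right_ket ?swap_sector // merge_swap.
have [eq_m|ne_m] := eqVneq (merge_word s t k i) (merge_word s t k (ordS i)).
  by rewrite swap_id // subrr !scaler0.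
congr (_ *: _); move: ne_m; rewrite /Theta !ffunE.
rewrite !subr_gt0 !subr_lt0 !ltz_nat -val_eqE /=.
have := @merge_letter_mono L s t k i (ordS i) st kt.
have := @merge_letter_mono L s t k (ordS i) i st kt.
set a := nat_of_ord (merge_letter s t (k i)).
set b := nat_of_ord (merge_letter s t (k (ordS i))).
rewrite -[X in X != _]/a -[X in _ != X]/b.
case: (ltngtP (k i) (k (ordS i))) => [_ _|_ +|/val_inj ki _ _].
- by move=> /(_ isT); case: ltngtP.
- by move=> /(_ isT); case: ltngtP.
- by rewrite /a /b ki eqxx.
Qed.

Lemma H_Y s : (H p q s @: Y K s <= Y K s)%VS.
Proof.
apply/subvP => w /memv_imgP[v Yv ->]; rewrite /Y memvE.
apply/subv_bigcapP => u us; rewrite -memvE memv_ker -comp_lfunE.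
rewrite phi_right_H ?proper_sub // comp_lfunE.
move: Yv; rewrite memvE => /subv_bigcapP /(_ u us).
by rewrite -memvE memv_ker => /eqP ->; rewrite linear0.
Qed.

Lemma Hdual_imgs s : (Hdual p q s @: imgs K s <= imgs K s)%VS.
Proof.
rewrite /imgs limg_sum; apply/subv_sumP => u us.
apply: subv_trans (sumv_sup u us (subvv _)).
apply/subvP => f /memv_imgP[g /memv_imgP[h _ ->] ->].
rewrite [phi_left _ _ _ _]dual_mapE dual_mapE -comp_lfunA.
rewrite phi_right_H ?proper_sub // comp_lfunA.
by rewrite -dual_mapE memv_img ?memvf.
Qed.

Lemma HX_pi s (f : Vdual K s) :
  HX p q s (quotv_pi (imgs K s) f) = quotv_pi (imgs K s) (f \o H p q s)%VF.
Proof. by rewrite quot_endE ?Hdual_imgs // dual_mapE. Qed.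

Lemma HY_val s (y : subvs_of (Y K s)) : vsval (HY p q s y) = H p q s (vsval y).
Proof. exact: sub_endE (H_Y s). Qed.

End SpacesTheory.

(* By duality one may use HY p q s instead of HX p q s. *)
Definition genuine_spectrum (C : closedFieldType) (L : nat) (p q : C)
  (s : sector L) : seq C := spectrum (HX p q s).

(* Main.v *)
Require Import Defs.
From mathcomp Require Import all_boot all_order all_algebra.
From mathcomp Require Import perm ring complex reals.

(* Refine a word of P(s) to permutations w. Then P(s) becomes the set of
   cosets of the parabolic subgroup generated by the letter exchanges
   e <-> e + 1 with e outside s, and the map of the theorem is: pull back,
   twist by the sign, reverse positions, project. If some e lies outside both
   sectors, exchanging e and e + 1 cancels the terms in pairs, so the map
   descends to the quotient and lands in Y; omega exchanges H with
   - L (p + q) - H because adjacent letters of a permutation differ.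

   Injectivity is a triangularity argument for the inversion sets. A
   permutation whose descent set (e + 1 to the left of e) contains s has the
   largest inversion set in its coset for the complement of s, and one whose
   descent set is contained in s has the smallest in its coset for s. Going
   down by number of inversions, the coefficient of a functional at w is zero
   when the descent set of w is s, and can be removed modulo the image of a
   smaller sector when the descent set is larger than s.

   The form <g| transfer f> on X* of s and of its complement is symmetric up
   to sign, so injectivity on both sides makes it perfect. This gives
   surjectivity, and the Gram matrix intertwines the matrix of H on one side
   with minus a constant minus the transposed matrix of H on the other. *)

Set Implicit Arguments.
Unset Strict Implicit.
Unset Printing Implicit Defensive.

Import Order.TTheory GRing.Theory Num.Theory.
Local Open Scope ring_scope.
Local Open Scope complex_scope.

(** * Permutations as refinements of the words of a sector *)

Section Words.

Variable L : nat.

Implicit Types (s t u v : sector L) (k : word L) (w z : {perm 'I_L}).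
Implicit Types (e : 'I_L.-1) (i j : 'I_L).

Lemma card_perm_lt w x : (x <= L)%N -> #|[set i | (w i < x)%N]| = x.
Proof.
move=> xL; rewrite -(card_imset _ (@perm_inj _ w)).
have -> : [set w i | i in [set i | (w i < x)%N]] = [set i : 'I_L | (i < x)%N].
  apply/setP => i; rewrite inE; apply/imsetP/idP => [[j]|ix].
    by rewrite inE => ? ->.
  by exists (w^-1%g i); rewrite ?inE permKV.
rewrite -sum1dep_card -[RHS]card_ord -sum1_card.
by rewrite (big_ord_widen _ (fun=> 1%N) xL).
Qed.

Lemma cut_setT x : (x <= L)%N -> cut [set: 'I_L.-1] x = x.
Proof.
rewrite /cut; case: x => //= j jL.
have -> : enum [set: 'I_L.-1] = enum 'I_L.-1.
  by rewrite !enumT; apply/all_filterP/allP => e _; rewrite inE.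
rewrite (map_comp S val) val_enum_ord.
have [jL1|jL1] := ltnP j L.-1.
  by rewrite (nth_map 0%N) ?size_iota // nth_iota.
rewrite nth_default ?size_map ?size_iota //; apply/eqP.
by rewrite eqn_leq jL andbT; case: (L) jL1.
Qed.

Lemma perm_sector_words w : (val w : word L) \in sector_words setT.
Proof.
apply/sector_wordsP => x xL; rewrite cut_setT // -[RHS](card_perm_lt w) //.
by apply: eq_card => i; rewrite !inE pvalE.
Qed.

Lemma sector_words_setT_inj k : k \in sector_words setT -> injective k.
Proof.
rewrite inE => /forallP kT i j kij.
have /cards1P[a Ea] : #|[set i' | k i' == k i]| == 1%N.
  by rewrite (eqP (kT (k i))) !cut_setT ?subSnn // ltnW.
have /set1P -> : i \in [set a] by rewrite -Ea inE.
by apply/esym/set1P; rewrite -Ea inE kij.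
Qed.

(** Sums over the basis of the full sector become sums over the symmetric group, where
    multiplication by a transposition can be used to reindex. *)
Lemma big_conf_setT (U : zmodType) (G : word L -> U) :
  \sum_(k : conf [set: 'I_L.-1]) G (val k) = \sum_(w : {perm 'I_L}) G (val w).
Proof.
pose h w : conf [set: 'I_L.-1] :=
    exist (fun k => k \in sector_words setT) _ (perm_sector_words w).
rewrite (reindex h) //; exists (fun c => perm (sector_words_setT_inj (valP c))).
  by move=> w _; apply/permP => i; rewrite permE /= pvalE.
by move=> c _; apply/val_inj/ffunP => i /=; rewrite pvalE permE.
Qed.

(** With letters counted from 0, this is the letter of the sector [s] to which the letter [x] of a
    permutation is merged; see [coarseE]. An element [e] of [s] marks the cut between the letters
    [e] and [e + 1]. *)
Definition blk s (x : nat) : nat := #|[set e in s | (e < x)%N]|.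

Definition coarse s w : word L := merge_word s setT (val w).

Lemma coarseE s w i : coarse s w i = blk s (w i) :> nat.
Proof.
rewrite ffunE merge_letterE ?subsetT ?perm_sector_words //.
by rewrite cut_setT ?pvalE // ltnW.
Qed.

Lemma coarse_sector s w : coarse s w \in sector_words s.
Proof. by rewrite merge_word_sector ?subsetT ?perm_sector_words. Qed.

Lemma coarse_comp s t w :
  s \subset t -> merge_word s t (coarse t w) = coarse s w.
Proof.
move=> st; apply/ffunP => i; apply: ord_inj.
rewrite ffunE merge_letterE ?coarse_sector // [RHS]coarseE coarseE.
set x := w i; set c := cut t (blk t x).
have cx : (c <= x)%N by rewrite leqNgt -card_lt_cut // ltnn.
(* As [c <= x], one set contains the other, and the smaller one already has [blk t x] elements. *)
have Et : [set e in t | (e < c)%N] = [set e in t | (e < x)%N].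
  apply/eqP; rewrite eqEcard; apply/andP; split.
    by apply/subsetP => e; rewrite !inE => /andP[-> /leq_trans ->].
  have <- : [set e in t | (index e (enum t) < blk t x)%N] =
            [set e in t | (e < c)%N].
    apply/setP => e; rewrite !inE.
    by case: (boolP (e \in t)) => //= /index_lt_cut ->.
  rewrite card_lt_index leq_min leqnn subset_leq_card //.
  by apply/subsetP => e; rewrite inE => /andP[].
apply: eq_card => e; have := congr1 (fun A : {set _} => e \in A) Et.
by rewrite !inE; case: (boolP (e \in s)) => //= es; rewrite (subsetP st).
Qed.

Lemma leq_blk s x y : (x <= y)%N -> (blk s x <= blk s y)%N.
Proof.
move=> xy; apply/subset_leq_card/subsetP => e; rewrite !inE => /andP[->].
by move/leq_trans->.
Qed.

Lemma blkS s e : blk s e.+1 = ((e \in s) + blk s e)%N.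
Proof.
rewrite /blk (cardsD1 e) !inE ltnSn andbT; congr (_ + _)%N.
by apply: eq_card => e'; rewrite !inE ltnS ltn_neqAle andbCA.
Qed.

(** * Position reversal, descent sets and inversion sets *)

Definition lower e : 'I_L := widen_ord (leq_pred L) e.

Fact upper_subproof e : (e.+1 < L)%N.
Proof. by rewrite -ltn_predRL. Qed.

Definition upper e : 'I_L := Ordinal (upper_subproof e).

Definition rev_perm w : {perm 'I_L} := (perm (@rev_ord_inj L) * w)%g.

Lemma rev_permE w i : rev_perm w i = w (rev_ord i).
Proof. by rewrite permM permE. Qed.

Lemma rev_permK : involutive rev_perm.
Proof. by move=> w; apply/permP => i; rewrite !rev_permE rev_ordK. Qed.

Lemma rev_word_perm w : rev_word (val w) = val (rev_perm w).
Proof. by apply/ffunP => i; rewrite ffunE !pvalE rev_permE. Qed.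

Lemma coarse_rev s w : coarse s (rev_perm w) = rev_word (coarse s w).
Proof. by apply/ffunP => i; rewrite /coarse -rev_word_perm !ffunE. Qed.

Lemma rev_word_inj : injective (@rev_word L).
Proof.
move=> k k' /ffunP kk; apply/ffunP => i; have := kk (rev_ord i).
by rewrite !ffunE rev_ordK.
Qed.

(* The letters e and e + 1 have the same image unless e is in s. *)
Lemma coarse_tperm s w e : e \notin s ->
  coarse s (w * tperm (lower e) (upper e))%g = coarse s w.
Proof.
move=> es; apply/ffunP => i; apply: ord_inj; rewrite /= !coarseE permM.
case: tpermP => [->|->|//] /=; by rewrite [blk s e.+1]blkS (negPf es).
Qed.

(** These are the descents of the inverse permutation, because [w] sends positions to letters. *)
Definition descent w : {set 'I_L.-1} :=
  [set e | (w^-1%g (upper e) < w^-1%g (lower e))%N].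

Lemma lower_neq_upper e : lower e != upper e.
Proof. by rewrite -val_eqE /= neq_ltn ltnSn. Qed.

Lemma descent_rev w : descent (rev_perm w) = ~: descent w.
Proof.
apply/setP => e; rewrite !inE.
have revV i : (rev_perm w)^-1%g i = rev_ord (w^-1%g i).
  apply: (@perm_inj _ (rev_perm w)).
  by rewrite permKV rev_permE rev_ordK permKV.
rewrite !revV /= ltn_sub2lE // ltnS -leqNgt [LHS]ltn_neqAle.
rewrite -[_ != _]/(w^-1%g (lower e) != w^-1%g (upper e)) (inj_eq perm_inj).
by rewrite lower_neq_upper.
Qed.

Definition inversions w : {set 'I_L * 'I_L} :=
  [set ij : 'I_L * 'I_L | (ij.1 < ij.2)%N && (w ij.2 < w ij.1)%N].

(** The letter [w i] is the number of positions carrying a smaller letter, and the inversion set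
    decides every such comparison. *)
Lemma inversions_inj : injective inversions.
Proof.
move=> w z /setP wz; apply/permP => i; apply: ord_inj.
rewrite -(card_perm_lt w (ltnW (ltn_ord (w i)))).
rewrite -[RHS](card_perm_lt z (ltnW (ltn_ord (z i)))).
apply: eq_card => j; rewrite !inE.
have := wz (i, j); have := wz (j, i); rewrite !inE /=.
case: (ltngtP i j) => //= [_ + _|/ord_inj -> _ _]; last by rewrite !ltnn.
have neq (x : {perm 'I_L}) a b : a != b -> (x a != x b :> nat).
  by move=> ab; rewrite val_eqE (inj_eq perm_inj).
have [-> //|ij] := eqVneq i j.
move/(congr1 negb); rewrite -!leqNgt leq_eqVlt [in RHS]leq_eqVlt.
by rewrite !(negPf (neq _ j i _)) /= 1?eq_sym.
Qed.

(** Two letters of one block are joined by a chain of steps from [e] to [e + 1] with [e] outside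
    [u]. Each such [e] is a descent, so the positions decrease along the chain. *)
Lemma block_decreasing u w i j :
    ~: u \subset descent w -> blk u (w i) = blk u (w j) -> (w i < w j)%N ->
  (j < i)%N.
Proof.
move=> uw.
have dec n (a b : 'I_L) : b = (a + n).+1 :> nat -> blk u a = blk u b ->
    (w^-1%g b < w^-1%g a)%N.
  elim: n b => [|n IH] b Eb Eblk.
    have eL : (a < L.-1)%N by rewrite ltn_predRL; rewrite -[a : nat]addn0 -Eb.
    pose e := Ordinal eL; have [Ea Ebb] : a = lower e /\ b = upper e.
      by split; apply: val_inj => //=; rewrite Eb addn0.
    have eu : e \in ~: u.
      rewrite inE; apply/negP => eu; move: Eblk.
      rewrite Eb addn0 (blkS u e) eu => /eqP.
      by rewrite -{1}[blk u a]add0n eqn_add2r.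
    by move/(subsetP uw): eu; rewrite inE Ea Ebb.
  have eL : (a + n.+1 < L.-1)%N by rewrite ltn_predRL -Eb.
  pose e := Ordinal eL; have Ebb : b = upper e by apply: val_inj => /=.
  have lee : (blk u a <= blk u e)%N by rewrite leq_blk //= leq_addr.
  have eu : e \in ~: u.
    rewrite inE; apply/negP => eu; move: lee.
    by rewrite Eblk Eb (blkS u e) eu ltnn.
  have Ee : blk u a = blk u e.
    by apply/eqP; rewrite eqn_leq lee Eblk leq_blk // Eb /=.
  apply: ltn_trans (IH (lower e) _ Ee); last by rewrite /= addnS.
  by move/(subsetP uw): eu; rewrite inE Ebb.
move=> Eb lt; have := dec (w j - w i).-1 (w i) (w j).
rewrite -addnS prednK ?subn_gt0 // subnKC ?(ltnW lt) // !permK.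
exact.
Qed.

(** A pair of positions in different blocks is compared in the same way by [z] and [w], and a pair
    in one block is always inverted by [w]. *)
Lemma inversions_subset u w z :
    ~: u \subset descent w -> coarse u z = coarse u w ->
  inversions z \subset inversions w.
Proof.
move=> uw /ffunP zw; have {}zw i : blk u (z i) = blk u (w i).
  by rewrite -!coarseE zw.
apply/subsetP => -[i j]; rewrite !inE /= => /andP[ij zij]; rewrite ij /=.
rewrite ltnNge; apply/negP; rewrite leq_eqVlt.
case/orP=> [/eqP/ord_inj/perm_inj E|wij].
  by rewrite E ltnn in ij.
have /(block_decreasing uw)/(_ wij) : blk u (w i) = blk u (w j).
  apply/eqP; rewrite eqn_leq leq_blk ?(ltnW wij) //=.
  by rewrite -!zw leq_blk // ltnW.
by rewrite ltnNge (ltnW ij).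
Qed.

(** Reversing the positions complements descent sets and exchanges inverted and non-inverted pairs,
    which reduces the claim to [inversions_subset]. *)
Lemma inversions_supset u w z :
    descent w \subset u -> coarse u z = coarse u w ->
  inversions w \subset inversions z.
Proof.
move=> wu zw.
have /subsetP sub : inversions (rev_perm z) \subset inversions (rev_perm w).
  apply: (@inversions_subset u); last by rewrite !coarse_rev zw.
  by rewrite descent_rev setCS.
apply/subsetP => -[i j]; rewrite !inE /= => /andP[ij wij]; rewrite ij /=.
rewrite ltnNge; apply/negP; rewrite leq_eqVlt.
case/orP=> [/eqP/ord_inj/perm_inj E|zij].
  by rewrite E ltnn in ij.
have := sub (rev_ord j, rev_ord i); rewrite !inE !rev_permE !rev_ordK /=.
by rewrite ltn_sub2lE // ltnS ij zij => /(_ isT); rewrite ltnNge (ltnW wij).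
Qed.

(* Equal letters are numbered from right to left. *)
Lemma coarse_surj t k : k \in sector_words t ->
  exists2 w : {perm 'I_L}, coarse t w = k & ~: t \subset descent w.
Proof.
(* [prec] lists the positions by letter, with ties broken from right to left; [w] will be the rank
   in this strict total order. *)
move=> kt; pose prec j i := (k j < k i)%N || ((k j == k i) && (i < j)%N).
have precxx i : prec i i = false by rewrite /prec !ltnn andbF.
have prec_trans i j i' : prec i j -> prec j i' -> prec i i'.
  rewrite /prec => /orP[ij|/andP[/eqP -> ij]] /orP[ji|/andP[/eqP <- ji]].
  - by rewrite (ltn_trans ij ji).
  - by rewrite ij.
  - by rewrite ji.
  - by rewrite eqxx (ltn_trans ji ij) orbT.
have prec_total i j : [|| prec i j, i == j | prec j i].
  rewrite /prec -[k i == _]val_eqE -[k j == _]val_eqE -[i == j]val_eqE /=.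
  by case: (ltngtP (k i) (k j)); case: (ltngtP i j).
pose before i := [set j | prec j i].
have rankL i : (#|before i| < L)%N.
  rewrite -[ltnRHS]card_ord -cardsT proper_card // properE subsetT /=.
  by apply/subsetPn; exists i; rewrite inE ?precxx.
have rank_lt i j : prec i j -> (#|before i| < #|before j|)%N.
  move=> ij; rewrite proper_card // properE; apply/andP; split.
    by apply/subsetP => a; rewrite !inE => /prec_trans; apply.
  by apply/subsetPn; exists i; rewrite inE ?precxx.
have rank_inj : injective (fun i => Ordinal (rankL i)).
  move=> i j [] E; case/or3P: (prec_total i j) => [/rank_lt|/eqP//|/rank_lt];
  by rewrite E ltnn.
pose w := perm rank_inj.
have wE i : w i = #|before i| :> nat by rewrite permE.
have w_lt i j : (w i < w j)%N -> prec i j.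
  case/or3P: (prec_total i j) => [//|/eqP ->|/rank_lt]; first by rewrite ltnn.
  by rewrite -!wE => ji ij; move: (ltn_trans ij ji); rewrite ltnn.
have Ew : coarse t w = k.
  (* There are [cut t y] positions with letter below [y], and they form an initial segment for
     [prec]; so they are the positions of rank below [cut t y]. *)
  have blk_lt i y : (y <= L)%N -> (blk t (w i) < y)%N = (k i < y)%N.
    move=> yL; rewrite card_lt_cut //.
    have /sector_wordsP <- // := kt; rewrite wE.
    have [kiy|yki] := ltnP (k i) y.
      apply: proper_card; rewrite properE; apply/andP; split.
        apply/subsetP => j; rewrite !inE => /orP[/ltn_trans|/andP[/eqP ->]//].
        exact.
      by apply/subsetPn; exists i; rewrite inE ?precxx.
    apply/negbTE; rewrite -leqNgt subset_leq_card //.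
    by apply/subsetP => j; rewrite !inE /prec => /leq_trans /(_ yki) ->.
  apply/ffunP => i; apply/ord_inj/eqP; rewrite /= coarseE eqn_leq.
  rewrite -ltnS blk_lt ?ltn_ord // ltnSn /= leqNgt blk_lt ?ltnn //.
  exact: ltnW.
exists w => //; apply/subsetP => e; rewrite !inE => et.
set i := w^-1%g (upper e); set j := w^-1%g (lower e).
have kij : k j = k i.
  apply: ord_inj; rewrite /= -Ew !coarseE !permKV /= (blkS t e).
  by rewrite (negPf et).
have /w_lt : (w j < w i)%N by rewrite !permKV.
by rewrite /prec kij ltnn eqxx.
Qed.

End Words.

(** * The map of the theorem at the level of words, and its kernel *)

Section Transfer.

Variables (K : numFieldType) (L : nat).

Implicit Types (s t u v : sector L) (w z : {perm 'I_L}).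

Let sgn w : K := (-1) ^+ odd_perm w.

Lemma omegaE (f : Vdual K [set: 'I_L.-1]) :
  omega K L f = \sum_w
    (sgn w * (f (ket K setT (val w)) : K)) *: ket K setT (val (rev_perm w)).
Proof.
rewrite /omega linfunE => [|a g h].
  rewrite (big_conf_setT (fun k =>
    ((-1) ^+ odd_word k * (f (ket K setT k) : K)) *: ket K setT (rev_word k))).
  by apply: eq_bigr => w _; rewrite odd_wordE rev_word_perm.
rewrite /= scaler_sumr -big_split /=; apply: eq_bigr => k _.
rewrite add_lfunE scale_lfunE scalerA -scalerDl; congr (_ *: _).
by rewrite mulrDr [in LHS]mulrCA.
Qed.

(** The two sectors are arbitrary here, so that composing with a merge on either side again gives a
    [transfer]. *)
Definition transfer s t : 'Hom(Vdual K t, V K s) :=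
  (phi_right K s setT \o omega K L \o phi_left K t setT)%VF.

Lemma transferE s t (f : Vdual K t) :
  transfer s t f = \sum_w
    (sgn w * (f (ket K t (coarse t w)) : K)) *: ket K s (coarse s (rev_perm w)).
Proof.
rewrite !comp_lfunE omegaE linear_sum; apply: eq_bigr => w _.
rewrite linearZ /= phi_right_ket ?perm_sector_words //.
by rewrite dual_mapE comp_lfunE phi_right_ket ?perm_sector_words.
Qed.

Lemma sgnM w z : sgn (w * z)%g = sgn w * sgn z.
Proof. by rewrite /sgn odd_permM signr_addb. Qed.

(* A letter exchange fixed by both coarsenings flips the sign of each term. *)
Lemma transfer_eq0 s t e (f : Vdual K t) :
  e \notin s -> e \notin t -> transfer s t f = 0.
Proof.
move=> es et; set x := transfer s t f.
have xN : x = - x.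
  rewrite {1}/x /x !transferE -sumrN.
  pose h w := (w * tperm (lower e) (upper e))%g.
  have hK : involutive h by move=> w; rewrite /h -mulgA tperm2 mulg1.
  rewrite (reindex h) /=; last by exists h => w _; apply: hK.
  apply: eq_bigr => w _; rewrite /h sgnM /sgn odd_tperm lower_neq_upper expr1.
  rewrite coarse_tperm // mulrN1 mulNr scaleNr.
  have -> : rev_perm (w * tperm (lower e) (upper e))%g =
    (rev_perm w * tperm (lower e) (upper e))%g by rewrite /rev_perm mulgA.
  by rewrite coarse_tperm.
(* Characteristic zero allows division by 2. *)
have : x *+ 2 = 0 by rewrite mulr2n {1}xN addNr.
by rewrite -scaler_nat => /eqP; rewrite scaler_eq0 pnatr_eq0 /= => /eqP.
Qed.

Lemma phi_leftE s t (f : Vdual K s) w : s \subset t ->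
  phi_left K s t f (ket K t (coarse t w)) = f (ket K s (coarse s w)).
Proof.
move=> st; rewrite dual_mapE comp_lfunE phi_right_ket ?coarse_sector //.
by rewrite coarse_comp.
Qed.

Lemma phi_right_transfer u s t (f : Vdual K t) : u \subset s ->
  phi_right K u s (transfer s t f) = transfer u t f.
Proof.
move=> us; rewrite !transferE linear_sum; apply: eq_bigr => w _.
by rewrite linearZ /= phi_right_ket ?coarse_sector // coarse_comp.
Qed.

Lemma transfer_phi_left s u t (g : Vdual K u) : u \subset t ->
  transfer s t (phi_left K u t g) = transfer s u g.
Proof.
by move=> ut; rewrite !transferE; apply: eq_bigr => w _; rewrite phi_leftE.
Qed.

(** Passing to a smaller [u] loses some [e] of [s]. This [e] is not in [t] either, so the projected
    image cancels in pairs. *)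
Lemma transfer_Y s t (f : Vdual K t) :
  t \subset ~: s -> transfer s t f \in Y K s.
Proof.
move=> ts; rewrite /Y memvE; apply/subv_bigcapP => u us.
rewrite -memvE memv_ker; case/properP: us => us [e es eu].
rewrite phi_right_transfer //.
rewrite (transfer_eq0 _ eu) //; apply/negP => /(subsetP ts).
by rewrite inE es.
Qed.

Lemma transfer_imgs s t (f : Vdual K t) :
  t \subset ~: s -> f \in imgs K t -> transfer s t f = 0.
Proof.
move=> ts /memv_sumP[g g_img ->]; rewrite linear_sum big1 //= => u ut.
have /memv_imgP[h _ ->] := g_img u ut.
case/properP: ut => ut [e et eu]; rewrite transfer_phi_left //.
rewrite (transfer_eq0 _ _ eu) //.
by have := subsetP ts _ et; rewrite inE.
Qed.

(** Each word has a refinement whose equal letters are numbered from right to left, so testing on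
    these refinements suffices. *)
Lemma Vdual_eq0 t (f : Vdual K t) :
  (forall w, ~: t \subset descent w -> f (ket K t (coarse t w)) = 0) -> f = 0.
Proof.
move=> f0; apply: Hom_ext => k /coarse_surj[w <- wt].
by rewrite f0 // zero_lfunE.
Qed.

Lemma transfer_inj s t (f : Vdual K t) :
  t = ~: s -> transfer s t f = 0 -> f \in imgs K t.
Proof.
move=> ts; have Ct : ~: t = s by rewrite ts setCK.
pose vanish m (g : Vdual K t) := forall w, s \subset descent w ->
  (m <= #|inversions w|)%N -> g (ket K t (coarse t w)) = 0.
suff main m g : transfer s t g = 0 -> vanish m g -> g \in imgs K t.
  (* This bound exceeds every number of inversions, so [vanish] holds vacuously. *)
  move=> f0; apply: (main #|{: 'I_L * 'I_L}|.+1 f f0) => w _.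
  by rewrite ltnNge max_card.
elim: m g => [|m IH] g g0 gm.
  by rewrite (@Vdual_eq0 _ g) ?mem0v // => w; rewrite Ct => wt; rewrite gm.
have gm' w : (m < #|inversions w|)%N -> g (ket K t (coarse t w)) = 0.
  move=> mw; have [z zw] := coarse_surj (coarse_sector t w); rewrite -zw => tz.
  rewrite gm -?Ct //; apply: leq_trans mw _; apply: subset_leq_card.
  exact: inversions_subset tz (esym zw).
(* In the coefficient of [transfer s t g] at [coarse s (rev_perm w)], every term other than [w] has
   more inversions, since [w] is minimal in its coset for [s]; only the term of [w] survives. *)
have gdesc w : descent w = s -> #|inversions w| = m ->
    g (ket K t (coarse t w)) = 0.
  move=> dw mw; have := congr1 (bra K s (coarse s (rev_perm w))) g0.
  rewrite linear0 transferE linear_sum (bigD1 w) //= linearZ /=.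
  rewrite bra_ket ?coarse_sector // eqxx big1 => [|z zw]; last first.
    rewrite linearZ /= bra_ket ?coarse_sector //.
    case: eqP => [Ez|_]; last by rewrite scaler0.
    have {}Ez : coarse s z = coarse s w.
      by apply: rev_word_inj; rewrite -!coarse_rev Ez.
    rewrite gm' ?mulr0 ?scale0r // -mw; apply: proper_card.
    rewrite properEneq (inversions_supset _ Ez) ?dw // andbT.
    by apply: contraNneq zw => /inversions_inj ->.
  rewrite addr0 => /eqP; rewrite scaler_eq0 oner_eq0 orbF mulf_eq0.
  by rewrite signr_eq0 => /eqP.
pose S := [pred w | [&& s \proper descent w & #|inversions w| == m]].
(* When the descent set contains [s], the complement of [u w] is the descent set itself, so [w] is
   maximal in its coset for [u w]. The functional [h w] is the indicator of that coset. *)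
pose u w : sector L := t :\: descent w.
pose h w : Vdual K t := phi_left K (u w) t (bra K (u w) (coarse (u w) w)).
have ut w : u w \subset t by apply: subsetDl.
have hE w z :
    h w (ket K t (coarse t z)) = (coarse (u w) w == coarse (u w) z)%:R.
  by rewrite phi_leftE // bra_ket ?coarse_sector.
have uw w : s \subset descent w -> ~: u w \subset descent w.
  move=> sw; rewrite /u setDE setCI Ct setCK subUset sw /=.
  exact: subxx.
(* Any [z] in the coset of [w] has its inversions among the [m] inversions of [w]; having at least
   [m] of them forces [z = w]. *)
have h_lt w z : w \in S -> z != w -> (m <= #|inversions z|)%N ->
    h w (ket K t (coarse t z)) = 0.
  case/andP=> /proper_sub sw /eqP mw zw mz; rewrite hE; case: eqP => // Ew.
  have sub := inversions_subset (uw w sw) (esym Ew); case/negP: zw.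
  apply/eqP/inversions_inj/eqP; rewrite eqEcard sub mw.
  exact: mz.
have himg w : w \in S -> h w \in imgs K t.
  case/andP=> /properP[sw [e ew es]] _; rewrite /imgs.
  have uS : u w \proper t.
    rewrite properE ut; apply/subsetPn; exists e; first by rewrite ts inE.
    by rewrite inE ew.
  by apply: (subvP (sumv_sup (u w) uS (subvv _))); rewrite memv_img ?memvf.
(* Subtracting [d] clears the values at all [w] in [S] without disturbing the other values at level
   [m] or above. *)
pose d := \sum_(w in S) (g (ket K t (coarse t w)) : K) *: h w.
have d_img : d \in imgs K t.
  by apply: rpred_sum => w wS; rewrite rpredZ ?himg.
rewrite -(subrK d g) rpredD // IH //.
  by rewrite linearB /= g0 [transfer _ _ d]transfer_imgs ?subrr // ts.
move=> z sz mz; rewrite add_lfunE opp_lfunE sum_lfunE.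
have [zS|zS] := boolP (z \in S).
  rewrite (bigD1 z) //= big1 => [|w /andP[wS wz]]; last first.
    by rewrite scale_lfunE h_lt ?scaler0 // eq_sym.
  by rewrite addr0 scale_lfunE hE eqxx [_ *: _]mulr1 subrr.
rewrite big1 => [|w wS]; last first.
  rewrite scale_lfunE h_lt ?scaler0 //.
  by apply: contraNneq zS => ->.
(* Outside [S], either there are more than [m] inversions, or the descent set is exactly [s]. *)
rewrite subr0; move: mz; rewrite leq_eqVlt => /orP[/eqP mz|/gm' //].
apply: gdesc => //; apply/eqP; rewrite eqEsubset sz andbT.
by move: zS; rewrite !inE properE sz -mz eqxx andbT /= negbK.
Qed.

Lemma sgn_rev w : sgn (rev_perm w) = sgn (rev_perm 1%g) * sgn w.
Proof. by rewrite -sgnM /rev_perm mulg1. Qed.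

(** Reindexing by [rev_perm] exchanges the two coarse words; the factor is the signature of the
    reversal. *)
Lemma transferC s t (f : Vdual K t) (g : Vdual K s) :
  g (transfer s t f) = (sgn (rev_perm 1%g) * (f (transfer t s g) : K)).
Proof.
rewrite !transferE !linear_sum mulr_sumr.
rewrite (reindex_inj (inv_inj (@rev_permK L))); apply: eq_bigr => w _.
rewrite !linearZ /= rev_permK sgn_rev /GRing.scale /= -!mulrA.
by congr (_ * (_ * _)); rewrite mulrC.
Qed.

(** * The sign twist and the Hamiltonian *)

Variables p q : K.

Lemma ThetaD (x : int) : x != 0 -> Theta p q x + Theta p q (- x) = p + q.
Proof.
by rewrite /Theta oppr_gt0 oppr_lt0; case: ltgtP => // _ _; rewrite addrC.
Qed.

(** Reversal exchanges the rates of the two orders of adjacent letters. The sign makes the exchange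
    terms opposite, while on the diagonal the two rates add up to [p + q] at each of the [L]
    sites. *)
Lemma H_omega (f : Vdual K [set: 'I_L.-1]) : (2 <= L)%N ->
  H p q setT (omega K L f) =
    - (L%:R * (p + q)) *: omega K L f - omega K L (f \o H p q setT)%VF.
Proof.
move=> L2.
have ordSE (i : 'I_L) : ordS i = (if i.+1 == L then 0 else i.+1)%N :> nat.
  rewrite /=; case: eqP => [->|iL]; first by rewrite modnn.
  by rewrite modn_small // ltn_neqAle ltn_ord andbT; apply/eqP.
have ordS_neq (i : 'I_L) : i != ordS i.
  apply/eqP => /(congr1 val)/esym; rewrite [val _]ordSE /=.
  case: (i.+1 =P L) => [iL i0|_ /esym/n_Sn//].
  by move: L2; rewrite -iL -i0.
pose sw i w : {perm 'I_L} := (tperm i (ordS i) * w)%g.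
have swE i w : swap (val w) i = val (sw i w).
  by apply/ffunP => j; rewrite ffunE !pvalE permM.
pose Th i w : K := Theta p q ((w i)%:Z - (w (ordS i))%:Z).
pose Th' i w : K := Theta p q ((w (ordS i))%:Z - (w i)%:Z).
have ThS i w : Th i w + Th' i w = p + q.
  rewrite /Th' -opprB ThetaD // subr_eq0 eqz_nat val_eqE (inj_eq perm_inj).
  exact: ordS_neq.
pose k w : V K [set: 'I_L.-1] := ket K setT (val w).
have Hk w : H p q setT (k w) = \sum_i Th i w *: (k (sw i w) - k w).
  rewrite H_ket ?perm_sector_words //; apply: eq_bigr => i _.
  by rewrite swE !pvalE.
(* Reversal sends the bond from [i] to [ordS i] to the bond that starts at the image of [ordS i]. *)
have rev_next (i : 'I_L) : ordS (rev_ord (ordS i)) = rev_ord i.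
  apply: ord_inj; rewrite [LHS]ordSE /= [X in (L - X.+1)%N]ordSE.
  case: (i.+1 =P L) => [->|iL].
    by rewrite subn1 prednK ?eqxx ?subnn // ltnW.
  rewrite subnSK; last by rewrite ltn_neqAle ltn_ord andbT; apply/eqP.
  by rewrite ltn_eqF // ltn_subrL (ltnW L2).
have Hkrev w : H p q setT (k (rev_perm w)) =
    \sum_i Th' i w *: (k (rev_perm (sw i w)) - k (rev_perm w)).
  rewrite Hk (reindex_inj (inj_comp (@rev_ord_inj L) (@ordS_inj L))) /=.
  apply: eq_bigr => i _; rewrite /Th !rev_permE rev_next !rev_ordK.
  congr (_ *: (k _ - _)); apply/permP => j.
  rewrite rev_permE !permM rev_next permE inj_tperm; last exact: rev_ord_inj.
  by rewrite !rev_ordK tpermC.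
pose a w : K := sgn w * (f (k w) : K); pose r w := k (rev_perm w).
have swK i : involutive (sw i) by move=> w; rewrite /sw mulgA tperm2 mul1g.
have aE i w : sgn w * (f (k (sw i w)) : K) = - a (sw i w).
  by rewrite /a sgnM /sgn odd_tperm ordS_neq expr1 mulN1r mulNr opprK.
have ThE i w : Th i (sw i w) = Th' i w by rewrite /Th !permM tpermL tpermR.
have LHS_E : H p q setT (omega K L f) =
    \sum_i \sum_w (a w * Th' i w) *: (r (sw i w) - r w).
  rewrite omegaE linear_sum exchange_big; apply: eq_bigr => w _.
  rewrite linearZ /= -/(k w) -/(k (rev_perm w)) Hkrev scaler_sumr.
  by apply: eq_bigr => i _; rewrite scalerA.
have RHS_E : omega K L (f \o H p q setT)%VF =
    \sum_i \sum_w (Th i w * (- a (sw i w) - a w)) *: r w.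
  rewrite omegaE exchange_big; apply: eq_bigr => w _.
  rewrite -scaler_suml; congr (_ *: _).
  rewrite comp_lfunE -/(k w) -/(k (rev_perm w)) Hk linear_sum mulr_sumr.
  apply: eq_bigr => i _; rewrite linearZ linearB /= -aE /a -mulrBr.
  by rewrite [LHS]mulrCA.
have omega_a : omega K L f = \sum_w a w *: r w by exact: omegaE.
rewrite LHS_E RHS_E omega_a -sumrN.
rewrite scaleNr -scalerA.
(* The constant is spread over the sites, after which the identity holds for each [i] separately. *)
have -> : L%:R *: ((p + q) *: \sum_w a w *: r w) =
    \sum_(i < L) (p + q) *: \sum_w a w *: r w.
  by rewrite sumr_const card_ord scaler_nat.
rewrite -sumrN -big_split /=; apply: eq_bigr => i _.
rewrite scaler_sumr -!sumrN -big_split /=.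
(* The exchange part is reindexed by [sw i], so that coefficients of [r w] can be compared. *)
have -> : \sum_w (a w * Th' i w) *: (r (sw i w) - r w) =
   \sum_w ((Th i w * a (sw i w)) *: r w - (a w * Th' i w) *: r w).
  rewrite sumrB [X in _ = X - _](reindex_inj (inv_inj (swK i))) -sumrB.
  by apply: eq_bigr => w _; rewrite scalerBr ThE swK [_ * a w]mulrC.
apply: eq_bigr => w _.
rewrite scalerA -!scaleNr -!scalerDl -(ThS i w); congr (_ *: _).
by ring.
Qed.

End Transfer.

(** * Characteristic polynomials and perfect pairings *)

Lemma char_poly_intertwine (K : fieldType) (m n : nat) (M : 'M[K]_m)
    (N : 'M[K]_n) (G : 'M[K]_(m, n)) :
  row_free G -> row_full G -> M *m G = G *m N -> char_poly M = char_poly N.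
Proof.
move=> Gfree Gfull; have mn : m = n by rewrite -(eqP Gfree) -[RHS](eqP Gfull).
(* [G] is now square and invertible; its determinant is nonzero over the polynomials and can be
   cancelled from the determinants of both sides. *)
subst n => MG; pose GX := map_mx polyC G.
have GX0 : \det GX != 0.
  rewrite det_map_mx polyC_eq0 -unitfE -unitmxE -row_free_unit.
  exact: Gfree.
have E : char_poly_mx M *m GX = GX *m char_poly_mx N.
  rewrite mulmxBl mulmxBr -!map_mxM MG; congr (_ - _).
  by rewrite mul_scalar_mx mul_mx_scalar.
apply: (mulIf GX0).
by rewrite -[X in X * _]/(\det _) -det_mulmx E det_mulmx mulrC.
Qed.

(** The matrix [X + c + M^T] is minus the transpose of [X - M] with [- X - c] substituted for
    [X]. *)
Lemma char_poly_reflect (K : comNzRingType) (n : nat) (M : 'M[K]_n) (c : K) :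
  char_poly (- c%:M - M^T) = (-1) ^+ n * (char_poly M \Po (- 'X - c%:P)).
Proof.
rewrite /char_poly -[\det (char_poly_mx M)]det_tr -[_ \Po _]det_map_mx -detZ.
congr (\det _).
apply/matrixP => i j; rewrite !mxE /= comp_polyB comp_polyC [j == i]eq_sym.
case: (i == j); rewrite ?mulr1n ?mulr0n ?comp_polyX ?comp_polyC !polyCB ?polyCN.
  by ring.
by rewrite raddf0; ring.
Qed.

Section PerfectPairing.

Variables (K : fieldType) (V1 V2 : vectType K) (B : V1 -> V2 -> K).

Hypothesis Bl : forall y, linear (B^~ y : V1 -> K^o).
Hypothesis Br : forall x, linear (B x : V2 -> K^o).
Hypothesis B_ker_l : forall x, (forall y, B x y = 0) -> x = 0.
Hypothesis B_ker_r : forall y, (forall x, B x y = 0) -> y = 0.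

Let e1 := vbasis {:V1}.
Let e2 := vbasis {:V2}.
Let e1P : basis_of {:V1} e1 := vbasisP _.
Let e2P : basis_of {:V2} e2 := vbasisP _.

Let gram : 'M[K]_(\dim {:V1}, \dim {:V2}) := \matrix_(i, j) B e1`_i e2`_j.

Let linear_sumE (V : vectType K) (g : V -> K^o) (gL : linear g) n
    (a : 'I_n -> K) (v : 'I_n -> V) :
  g (\sum_i a i *: v i) = \sum_i a i * g (v i).
Proof.
rewrite -(linfunE gL) linear_sum; apply: eq_bigr => i _.
by rewrite linearZ /= linfunE.
Qed.

Let gramE u v :
  B (passmx.vecof e1 u) (passmx.vecof e2 v) = (u *m gram *m v^T) 0 0.
Proof.
rewrite /passmx.vecof (linear_sumE (Bl _)) -mulmxA mxE; apply: eq_bigr => i _.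
rewrite (linear_sumE (Br _)) mxE; congr (_ * _).
by apply: eq_bigr => j _; rewrite !mxE mulrC.
Qed.

Let gram_free : row_free gram.
Proof.
rewrite -kermx_eq0; apply/eqP/row_matrixP => i; rewrite row0.
set u := row i _; have uG : u *m gram = 0.
  by rewrite /u -row_mul mulmx_ker row0.
suff : passmx.vecof e1 u = 0 by move/eqP; rewrite passmx.vecof_eq0 // => /eqP.
apply: B_ker_l => y; rewrite -[y](passmx.rVofK e2P) gramE uG mul0mx.
by rewrite mxE.
Qed.

Let gram_full : row_full gram.
Proof.
rewrite /row_full -mxrank_tr -[_ == _]/(row_free gram^T).
rewrite -kermx_eq0; apply/eqP/row_matrixP => i; rewrite row0.
set v := row i _; have Gv : gram *m v^T = 0.
  by apply: trmx_inj; rewrite trmx_mul trmxK trmx0 /v -row_mul mulmx_ker row0.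
suff : passmx.vecof e2 v = 0 by move/eqP; rewrite passmx.vecof_eq0 // => /eqP.
apply: B_ker_r => x; rewrite -[x](passmx.rVofK e1P) gramE -mulmxA Gv mulmx0.
by rewrite mxE.
Qed.

(** Since the kernel on the right is trivial, the rows of [gram] span all row vectors, in particular
    the coordinates of [g]. *)
Lemma pairing_represent (g : V2 -> K^o) :
  linear g -> exists x, forall y, B x y = g y.
Proof.
move=> gL; pose r : 'rV[K]_(\dim {:V2}) := \row_j g e2`_j.
have /submxP[u Eu] : (r <= gram)%MS by rewrite submx_full.
exists (passmx.vecof e1 u) => y; rewrite -[y](passmx.rVofK e2P) gramE -Eu.
rewrite /passmx.vecof (linear_sumE gL) mxE.
by apply: eq_bigr => j _; rewrite [r _ _]mxE [_^T _ _]mxE mulrC.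
Qed.

Lemma pairing_char_poly (f1 : 'End(V1)) (f2 : 'End(V2)) (c : K) :
    (forall x y, B (f1 x) y = - c * B x y - B x (f2 y)) ->
  char_poly (passmx.mxof e1 e1 f1) =
    char_poly (- c%:M - (passmx.mxof e2 e2 f2)^T).
Proof.
move=> Bf; apply: (char_poly_intertwine gram_free gram_full).
apply/matrixP => i j.
(* Entries are written as values at unit vectors, so that [gramE] turns the hypothesis on [B] into a
   matrix identity. *)
have entry (A : 'M[K]_(\dim {:V1}, \dim {:V2})) :
    A i j = ((delta_mx 0 i : 'rV_ _) *m A *m (delta_mx 0 j : 'rV_ _)^T) 0 0.
  by rewrite -rowE trmx_delta -colE !mxE.
have vecof_mx (V : vectType K) (e : (\dim {:V}).-tuple V) (f : 'End(V)) u :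
    basis_of {:V} e ->
    f (passmx.vecof e u) = passmx.vecof e (u *m passmx.mxof e e f).
  by move=> eP; rewrite passmx.mul_mxof // passmx.rVofK.
rewrite [LHS]entry [RHS]entry mulmxA -gramE -vecof_mx // Bf.
rewrite (vecof_mx _ e2) // !gramE trmx_mul.
rewrite mulmxBr mulmxN mul_mx_scalar mulmxBr mulmxN -scalemxAr mulmxBl mulNmx.
rewrite -scalemxAl [RHS]mxE [in RHS]mxE [in RHS]mxE !mulmxA mulNr.
by rewrite [X in _ = _ + X]mxE.
Qed.

End PerfectPairing.

Lemma spectrum_pairing (C : closedFieldType) (V1 V2 : vectType C)
    (B : V1 -> V2 -> C) (f1 : 'End(V1)) (f2 : 'End(V2)) (c : C) :
    (forall y, linear (B^~ y : V1 -> C^o)) ->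
    (forall x, linear (B x : V2 -> C^o)) ->
    (forall x, (forall y, B x y = 0) -> x = 0) ->
    (forall y, (forall x, B x y = 0) -> y = 0) ->
    (forall x y, B (f1 x) y = - c * B x y - B x (f2 y)) ->
  perm_eq (spectrum f1) [seq - c - E | E <- spectrum f2].
Proof.
move=> Bl Br Bkl Bkr Bf; apply: prod_XsubC_eq; rewrite big_map.
have := pairing_char_poly Bl Br Bkl Bkr Bf.
rewrite /spectrum; case: closed_field_poly_normal => r1 /= E1.
case: closed_field_poly_normal => r2 /= E2; rewrite char_poly_reflect.
move: E1 E2; rewrite !(monicP (char_poly_monic _)) !scale1r => -> E2.
(* The sign in [char_poly_reflect] has one factor -1 per root, which turns each [- X - c - z] into
   [X - (- c - z)]. *)
have dimE : \dim {:V2} = size r2.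
  pose M := passmx.mxof (vbasis {:V2}) (vbasis {:V2}) f2.
  apply/eqP; rewrite -eqSS -(size_char_poly M) /M.
  by rewrite E2 size_prod_XsubC.
rewrite E2 dimE => ->; elim: r2 {E2 dimE} => [|z r IH].
  by rewrite !big_nil mul1r comp_polyC.
rewrite !big_cons -IH exprS comp_polyM comp_polyB comp_polyX comp_polyC.
rewrite polyCB polyCN; ring.
Qed.

Lemma quotv_pi_eq0 (F : fieldType) (vT : vectType F) (U : {vspace vT}) v :
  v \in U -> quotv_pi U v = 0.
Proof.
by move=> Uv; apply/eqP; rewrite -(linear0 (quotv_pi U)) quotv_piE subr0.
Qed.

(** * The induced map and pairing on the genuine components *)

Section GenuineComponents.

Variables (K : numFieldType) (L : nat).

Implicit Types (s t u : sector L).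

Lemma Vdual_separates s (v : V K s) : (forall f : Vdual K s, f v = 0) -> v = 0.
Proof.
move=> v0; rewrite [v]V_basis big1 // => k _.
have := v0 (bra K s (val k)); rewrite [in X in X -> _](V_basis v) linear_sum.
rewrite (bigD1 k) //= linearZ /= bra_ket; last exact: valP.
rewrite eqxx big1 => [|j jk]; last first.
  rewrite linearZ /= bra_ket; last exact: valP.
  by rewrite (inj_eq val_inj) eq_sym (negPf jk) scaler0.
by rewrite addr0 [_ *: _]mulr1 => ->; rewrite scale0r.
Qed.

(** A functional pulled back along a merge to a smaller sector factors through a map that kills [Y].
    Hence classes modulo [imgs] have well-defined values on [Y]. *)
Lemma imgs_Y s (f : Vdual K s) (v : V K s) :
  f \in imgs K s -> v \in Y K s -> f v = 0.
Proof.
move=> /memv_sumP[g g_img ->] Yv; rewrite sum_lfunE big1 //= => u us.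
have /memv_imgP[h _ ->] := g_img u us; rewrite dual_mapE comp_lfunE.
move: Yv; rewrite /Y memvE => /subv_bigcapP /(_ u us).
by rewrite -memvE memv_ker => /eqP ->; rewrite linear0.
Qed.

Lemma repr_pi s (f : Vdual K s) :
  f - repr (quotv_pi (imgs K s) f) \in imgs K s.
Proof. by rewrite -quotv_piE quotv_reprK. Qed.

Lemma repr_pi_Y s (f : Vdual K s) (v : V K s) :
  v \in Y K s -> repr (quotv_pi (imgs K s) f) v = f v.
Proof.
move=> Yv; apply/esym/eqP; rewrite -subr_eq0 -opp_lfunE -add_lfunE.
by rewrite (imgs_Y (repr_pi f) Yv).
Qed.

Variables (s t : sector L).
Hypothesis ts : t = ~: s.

Let tS : t \subset ~: s. Proof. by rewrite ts. Qed.
Let st : s = ~: t. Proof. by rewrite ts setCK. Qed.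

Lemma transfer_repr (f : Vdual K t) :
  transfer K s t (repr (quotv_pi (imgs K t) f)) = transfer K s t f.
Proof.
apply/esym/eqP; rewrite -subr_eq0 -linearB /=.
by rewrite [transfer _ _ _ _](transfer_imgs tS (repr_pi f)).
Qed.

Definition genuine_map : 'Hom(X K t, subvs_of (Y K s)) :=
  linfun (fun x : X K t => vsproj (Y K s) (transfer K s t (repr x))).

Lemma genuine_mapE (f : Vdual K t) :
  vsval (genuine_map (quotv_pi (imgs K t) f)) = transfer K s t f.
Proof.
rewrite /genuine_map linfunE => [|a x y].
  by rewrite vsprojK transfer_repr // transfer_Y.
rewrite -[x]quotv_reprK -[y]quotv_reprK -quotv_piZ -quotv_piD !transfer_repr.
by rewrite !linearP.
Qed.

(** The choice of representatives is immaterial: [transfer] kills [imgs] and lands in [Y], where the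
    second argument acts through its class. *)
Definition genuine_pairing (x : X K t) (y : X K s) : K :=
  repr y (transfer K s t (repr x)).

Lemma genuine_pairingE (f : Vdual K t) (g : Vdual K s) :
  genuine_pairing (quotv_pi (imgs K t) f) (quotv_pi (imgs K s) g) =
    g (transfer K s t f).
Proof. by rewrite /genuine_pairing transfer_repr repr_pi_Y // transfer_Y. Qed.

Lemma genuine_pairing_linear_l y : linear (genuine_pairing^~ y : X K t -> K^o).
Proof.
move=> a x x'; rewrite -[x]quotv_reprK -[x']quotv_reprK -quotv_piZ -quotv_piD.
by rewrite -[y]quotv_reprK !genuine_pairingE !linearP.
Qed.

Lemma genuine_pairing_linear_r x : linear (genuine_pairing x : X K s -> K^o).
Proof.
move=> a y y'; rewrite -[y]quotv_reprK -[y']quotv_reprK -quotv_piZ -quotv_piD.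
by rewrite -[x]quotv_reprK !genuine_pairingE add_lfunE scale_lfunE.
Qed.

Lemma genuine_pairing_ker_l x : (forall y, genuine_pairing x y = 0) -> x = 0.
Proof.
rewrite -[x]quotv_reprK => x0; apply/quotv_pi_eq0/(transfer_inj ts).
by apply: Vdual_separates => g; rewrite -genuine_pairingE.
Qed.

(** By [transferC] this is injectivity of [transfer] with the two sectors exchanged. *)
Lemma genuine_pairing_ker_r y : (forall x, genuine_pairing x y = 0) -> y = 0.
Proof.
rewrite -[y]quotv_reprK => y0; apply/quotv_pi_eq0/(transfer_inj st).
apply: Vdual_separates => f.
by rewrite transferC -genuine_pairingE y0 mulr0.
Qed.

Lemma genuine_map_bij : bijective genuine_map.
Proof.
have inj : injective genuine_map.
  move=> x x' xx; apply/eqP; rewrite -subr_eq0; apply/eqP.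
  move: xx; rewrite -[x]quotv_reprK -[x']quotv_reprK -linearB /=.
  move/(congr1 vsval); rewrite !genuine_mapE => /eqP.
  rewrite -subr_eq0 -linearB => /eqP /(transfer_inj ts).
  exact: quotv_pi_eq0.
(* Evaluation at [y] is a linear form on the dual component of [s]; the perfect pairing represents
   it by some [x], whose image agrees with [y] under all functionals. *)
have surj y : exists x, genuine_map x == y.
  have lin_y : linear (fun z : X K s => repr z (vsval y) : K^o).
    move=> a z z'; rewrite -[z]quotv_reprK -[z']quotv_reprK.
    rewrite -quotv_piZ -quotv_piD.
    by rewrite !repr_pi_Y ?subvsP // add_lfunE scale_lfunE.
  have [x xy] := pairing_represent genuine_pairing_linear_l
    genuine_pairing_linear_r genuine_pairing_ker_r lin_y.
  exists x; apply/eqP/val_inj; rewrite -[x]quotv_reprK.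
  rewrite -[LHS]/(vsval _) genuine_mapE.
  apply/eqP; rewrite -subr_eq0; apply/eqP.
  apply: Vdual_separates => g; rewrite linearB /= -genuine_pairingE quotv_reprK.
  by rewrite xy repr_pi_Y ?subvsP // subrr.
exists (fun y => xchoose (surj y)) => [x|y]; last exact/eqP/(xchooseP (surj y)).
by apply: inj; apply/eqP/(xchooseP (surj _)).
Qed.

Variables p q : K.
Hypothesis L2 : (2 <= L)%N.

(** Merges commute with the Hamiltonian, so [H_omega] passes from the full sector to [s] and [t]. *)
Lemma transfer_H (f : Vdual K t) :
  transfer K s t (f \o H p q t)%VF =
    - (L%:R * (p + q)) *: transfer K s t f - H p q s (transfer K s t f).
Proof.
have -> : H p q s (transfer K s t f) =
    phi_right K s setT (H p q setT (omega K L (phi_left K t setT f))).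
  by rewrite -[RHS]comp_lfunE phi_right_H ?subsetT // !comp_lfunE.
rewrite H_omega // linearB linearZ /=.
have -> : transfer K s t f =
    phi_right K s setT (omega K L (phi_left K t setT f)).
  by rewrite !comp_lfunE.
rewrite opprB addrC subrK !comp_lfunE; congr (phi_right _ _ _ (omega _ _ _)).
by rewrite !dual_mapE -!comp_lfunA phi_right_H ?subsetT.
Qed.

Lemma genuine_map_H x :
  genuine_map (HX p q t x) =
    - (L%:R * (p + q)) *: genuine_map x - HY p q s (genuine_map x).
Proof.
rewrite -[x]quotv_reprK; apply: val_inj.
rewrite -[LHS]/(vsval _) -[RHS]/(vsval _) linearB linearZ /=.
by rewrite HY_val HX_pi !genuine_mapE transfer_H.
Qed.

Lemma genuine_pairing_H x y :
  genuine_pairing (HX p q t x) y =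
    - (L%:R * (p + q)) * genuine_pairing x y - genuine_pairing x (HX p q s y).
Proof.
rewrite -[x]quotv_reprK -[y]quotv_reprK !HX_pi !genuine_pairingE transfer_H.
by rewrite linearB linearZ /= [(repr y \o _)%VF _]comp_lfunE.
Qed.

End GenuineComponents.

Theorem theorem4p12 (R : realType) (L : nat) (p q : R) (s : sector L)
    (hL : (2 <= L)%N) (hp : 0 <= p) (hq : 0 <= q) :
  let c : R[i] := (L%:R * (p + q))%:C in
  (exists w : 'Hom(X R[i] (~: s), subvs_of (Y R[i] s)),
    [/\ forall f : Vdual R[i] (~: s),
          vsval (w (quotv_pi (imgs R[i] (~: s)) f))
          = phi_right R[i] s setT (omega R[i] L (phi_left R[i] (~: s) setT f)),
        bijective w &
        forall (E : R[i]) (x : X R[i] (~: s)),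
          x != 0 -> HX p%:C q%:C (~: s) x = E *: x ->
          w x != 0 /\ HY p%:C q%:C s (w x) = (- c - E) *: w x]) /\
  perm_eq (genuine_spectrum p%:C q%:C (~: s))
          [seq - c - E | E <- genuine_spectrum p%:C q%:C s].
Proof.
move=> c; have -> : c = L%:R * (p%:C + q%:C).
  by rewrite /c rmorphM rmorphD rmorph_nat.
have ts : ~: s = ~: s by [].
split; last first.
  (* Both spectra are taken on quotients, so the pairing compares them directly, without passing
     through [Y]. *)
  apply: (spectrum_pairing (genuine_pairing_linear_l ts)
    (genuine_pairing_linear_r ts) (genuine_pairing_ker_l ts)
    (genuine_pairing_ker_r ts)).
  exact: genuine_pairing_H.
exists (genuine_map R[i] s (~: s)); split.
- by move=> f; rewrite genuine_mapE // !comp_lfunE.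
- exact: genuine_map_bij.
move=> E x x0 Ex; split.
  apply: contraNneq x0 => wx0; apply/eqP/(bij_inj (genuine_map_bij _ ts)).
  by rewrite wx0 linear0.
have := genuine_map_H ts p%:C q%:C hL x.
rewrite Ex linearZ /= => Ew.
by rewrite scalerBl Ew opprB addrC subrK.
Qed.
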